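(* Let $(\mathcal{B},\mathcal{L},\theta,\mathcal{I}_\alpha)$ be a generalized Boolean dynamical system and $S$ be its associated inverse semigroup. Then the tight filters in $E(S)$ are exactly: (i) the ultrafilters of infinite type; (ii) the filters of finite type $\xi^\alpha$ such that $\xi_{|\alpha|}$ is an ultrafilter (in $\mathcal{I}_\alpha$) and $A\notin\mathcal{B}_{reg}$ for all $A\in\xi_{|\alpha|}$.
   Context: **Generalized Boolean dynamical systems.** A Boolean algebra $\mathcal{B}$ is a (not necessarily unital) relatively complemented distributive lattice with least element $\emptyset$ and operations $\cap,\cup,\setminus$; $A\subseteq B$ means $A\cap B=A$. An ideal is a non-empty subset closed under finite unions and under intersection with arbitrary elements of $\mathcal{B}$. An action is a map $\mathcal{B}\to\mathcal{B}$ preserving $\cap,\cup,\setminus$ and $\emptyset$. A generalized Boolean dynamical system $(\mathcal{B},\mathcal{L},\theta,\mathcal{I}_\alpha)$ consists of a Boolean algebra $\mathcal{B}$, a set $\mathcal{L}$, actions $\{\theta_\alpha\}_{\alpha\in\mathcal{L}}$ and ideals $\{\mathcal{I}_\alpha\}_{\alpha\in\mathcal{L}}$ with $\{A\in\mathcal{B}:A\subseteq\theta_\alpha(B)\text{ for some }B\in\mathcal{B}\}\subseteq\mathcal{I}_\alpha$ for all $\alpha\in\mathcal{L}$. For $B\in\mathcal{B}$, $\Delta_B=\{\alpha\in\mathcal{L}:\theta_\alpha(B)\neq\emptyset\}$; $A\in\mathcal{B}$ is regular, $A\in\mathcal{B}_{reg}$, if $0<|\Delta_B|<\infty$ for every $\emptyset\neq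 B\subseteq A$. **Words.** $\mathcal{L}^*$: finite words over $\mathcal{L}$ (including the empty word $\emptyset$); $\mathcal{L}^\infty$: infinite words; $|\alpha|$: length; $\alpha_{i,j}=\alpha_i\cdots\alpha_j$ (empty if $j<i$). For $\alpha=\alpha_1\cdots\alpha_n$: $\theta_\alpha=\theta_{\alpha_n}\circ\cdots\circ\theta_{\alpha_1}$, $\theta_\emptyset=\mathrm{Id}$; $\mathcal{I}_\alpha=\{A\in\mathcal{B}:A\subseteq\theta_{\alpha_2\cdots\alpha_n}(B)\text{ for some }B\in\mathcal{I}_{\alpha_1}\}$ for $n\ge1$, $\mathcal{I}_\emptyset=\mathcal{B}$. $\mathcal{W}^*=\{\alpha\in\mathcal{L}^*:\mathcal{I}_\alpha\neq\{\emptyset\}\}$, $\mathcal{W}^\infty=\{\alpha\in\mathcal{L}^\infty:\alpha_{1,n}\in\mathcal{W}^*\ \forall n\geq1\}$, $\mathcal{W}^{\leq\infty}=\mathcal{W}^*\cup\mathcal{W}^\infty$. **Inverse semigroup.** $S=\{(\alpha,A,\beta):\alpha,\beta\in\mathcal{L}^*,\ \emptyset\neq A\in\mathcal{I}_\alpha\cap\mathcal{I}_\beta\}\cup\{0\}$, with $0$ absorbing and $(\alpha,A,\beta)(\gamma,B,\delta)$ equal to $(\alpha,A\cap B,\delta)$ if $\beta=\gamma$; $(\alpha\gamma',\theta_{\gamma'}(A)\cap B,\delta)$ if $\gamma=\beta\gamma'$; $(\alpha,A\cap\theta_{\beta'}(B),\delta\beta')$ if $\beta=\gamma\beta'$ (interpreted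 as $0$ when the middle entry is $\emptyset$); $0$ otherwise. Its semilattice of idempotents is $E(S)=\{(\alpha,A,\alpha):\emptyset\neq A\in\mathcal{I}_\alpha\}\cup\{0\}$, ordered by $e\le f$ iff $ef=e$. **Filters.** A filter in a poset with least element is a non-empty, upward closed, downward directed subset not containing the least element; an ultrafilter is a maximal filter. Each filter $\xi$ in $E(S)$ has an associated word $\alpha\in\mathcal{W}^{\leq\infty}$: the longest first entry of elements of $\xi$ if these have bounded length, otherwise the unique infinite word of which all first entries of elements of $\xi$ are beginnings. Write $\xi=\xi^\alpha$ and $\xi_n=\{A\in\mathcal{I}_{\alpha_{1,n}}:(\alpha_{1,n},A,\alpha_{1,n})\in\xi\}$ for $0\le n\le|\alpha|$, $n<\infty$. $\xi^\alpha$ is of finite type if $|\alpha|<\infty$ and of infinite type otherwise. A subset $Z\subseteq\{y\in E(S):y\le x\}$ is a cover for $x\in E(S)$ if every $0\neq y\le x$ satisfies $yz\neq0$ for some $z\in Z$; a filter $\xi$ is tight if for every $x\in\xi$ and every finite cover $Z$ for $x$ one has $Z\cap\xi\neq\emptyset$. *)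

(* Defs.v *)
From mathcomp Require Import all_boot all_order.
From mathcomp Require Import boolp classical_sets functions cardinality.

Set Implicit Arguments.
Unset Strict Implicit.
Unset Printing Implicit Defensive.

Import Order.Theory.

Local Open Scope classical_set_scope.
Local Open Scope order_scope.

(* A Boolean algebra without unit is a [cbDistrLatticeType]: a distributive
   lattice with bottom and relative complements.  Alphabets are [eqType]s so
   that the case distinction in the semigroup product is computable.           *)

Section GBDS.
Context {d : Order.disp_t} {B : cbDistrLatticeType d} {L : eqType}.
Implicit Types (A C : B) (a : L) (al be : seq L).

Definition is_ideal (J : set B) : Prop :=
  [/\ J !=set0,
      forall A C, J A -> J C -> J (A `|` C) &
      forall A C, J A -> J (A `&` C)].

Definition is_action (f : B -> B) : Prop :=
  [/\ {morph f : A C / A `&` C},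
      {morph f : A C / A `|` C},
      {morph f : A C / A `\` C} &
      f \bot = \bot].

End GBDS.

Record gbds (d : Order.disp_t) (B : cbDistrLatticeType d) (L : eqType) := Gbds {
  act : L -> B -> B;
  idl : L -> set B;
  actP : forall a, is_action (act a);
  idlP : forall a, is_ideal (idl a);
  act_sub_idl : forall a A, (exists C, A <= act a C) -> idl a A
}.

Section Words.
Context {d : Order.disp_t} {B : cbDistrLatticeType d} {L : eqType}.
Variable G : gbds B L.
Implicit Types (A C : B) (a : L) (al be : seq L).

Definition Delta A : set L := [set a | act G a A <> \bot].

Definition regular A : Prop :=
  forall C, C <> \bot -> C <= A -> Delta C !=set0 /\ finite_set (Delta C).

(* The first letter acts first. *)
Definition word_act al A : B := foldl (fun C a => act G a C) A al.

Definition word_idl al : set B :=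
  if al is a :: al' then [set A | exists2 C, idl G a C & A <= word_act al' C]
  else [set: B].

Definition Wstar al : Prop := word_idl al <> [set \bot].

End Words.

Section ExtendedWords.
Context {L : Type}.

Inductive xword := Fin of seq L | Inf of nat -> L.

(* The beginning of length n (all of [al] if n exceeds the length of [al]). *)
Definition xtake (n : nat) (w : xword) : seq L :=
  match w with Fin al => take n al | Inf u => mkseq u n end.

End ExtendedWords.
Arguments xword : clear implicits.

Definition Wle (d : Order.disp_t) (B : cbDistrLatticeType d) (L : eqType)
    (G : gbds B L) (w : xword L) : Prop :=
  match w with
  | Fin al => Wstar G al
  | Inf u => forall n, (1 <= n)%N -> Wstar G (mkseq u n)
  end.

Section Semigroup.
Context {d : Order.disp_t} {B : cbDistrLatticeType d} {L : eqType}.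
Variable G : gbds B L.
Implicit Types (A C : B) (al be ga de : seq L).

Definition triple : Type := (seq L * B * seq L)%type.

Definition valid (t : triple) : bool :=
  let: (al, A, be) := t in
  `[< [/\ A <> \bot, word_idl G al A & word_idl G be A] >].

(* The zero element is [None]. *)
Definition isg : Type := option {t : triple | valid t}.

(* The element (al, A, be), read as zero if this triple is not valid; by
   [prod_valid] below, in a product this only happens for an empty middle
   entry.                                                                      *)
Definition elt al A be : isg := insub (al, A, be).

Definition prod_triple (s t : triple) : option triple :=
  let: (al, A, be) := s in
  let: (ga, C, de) := t in
  if be == ga then Some (al, A `&` C, de)
  else if prefix be ga then
    let ga' := drop (size be) ga in
    Some (al ++ ga', word_act G ga' A `&` C, de)
  else if prefix ga be then
    let be' := drop (size ga) be in
    Some (al, A `&` word_act G be' C, de ++ be')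
  else None.

Definition smul (s t : isg) : isg :=
  match s, t with
  | Some s, Some t =>
    if prod_triple (val s) (val t) is Some (al, A, be) then elt al A be
    else None
  | _, _ => None
  end.

Definition ES : set isg :=
  [set e | if e is Some t then (val t).1.1 = (val t).2 else True].

Definition sle (e f : isg) : Prop := smul e f = e.

End Semigroup.

Section Filters.
Context {T : Type}.
Variables (le : T -> T -> Prop) (bot : T) (P : set T).

(* Filters of the poset P with the order [le] and the least element [bot]. *)
Definition is_filter (F : set T) : Prop :=
  [/\ F `<=` P, F !=set0, ~ F bot,
      forall x y, F x -> P y -> le x y -> F y &
      forall x y, F x -> F y -> exists z, [/\ F z, le z x & le z y]].

Definition is_ultrafilter (F : set T) : Prop :=
  is_filter F /\ forall F', is_filter F' -> F `<=` F' -> F' = F.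

End Filters.

Section FiltersES.
Context {d : Order.disp_t} {B : cbDistrLatticeType d} {L : eqType}.
Variable G : gbds B L.
Implicit Types (xi : set (isg G)) (al be : seq L) (w : xword L) (u : nat -> L).

Definition filterES xi : Prop := is_filter (@sle _ _ _ G) None (@ES _ _ _ G) xi.

Definition ultrafilterES xi : Prop :=
  is_ultrafilter (@sle _ _ _ G) None (@ES _ _ _ G) xi.

Definition ultrafilter_idl al (F : set B) : Prop :=
  is_ultrafilter (fun A C : B => A <= C) \bot (word_idl G al) F.

Definition first_entries xi : set (seq L) :=
  [set al | exists2 t, xi (Some t) & (val t).1.1 = al].

(* Existence and uniqueness of the associated word of a filter, and the fact
   that it is in W^{<= oo}, are [assoc_word_ex] and [assoc_word_uniq] below.   *)
Definition assoc_word xi w : Prop :=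
  match w with
  | Fin al => first_entries xi al /\
      forall be, first_entries xi be -> (size be <= size al)%N
  | Inf u => ~ (exists n, forall be, first_entries xi be -> (size be <= n)%N) /\
      forall be, first_entries xi be -> be = mkseq u (size be)
  end.

Definition infinite_type xi : Prop := exists u, assoc_word xi (Inf u).

Definition level xi w (n : nat) : set B :=
  [set A | word_idl G (xtake n w) A /\ xi (elt G (xtake n w) A (xtake n w))].

Definition is_cover (x : isg G) (Z : set (isg G)) : Prop :=
  Z `<=` [set y | ES y /\ sle y x] /\
  forall y, ES y -> y <> None -> sle y x -> exists2 z, Z z & smul y z <> None.

Definition is_tight xi : Prop :=
  filterES xi /\
  forall x Z, xi x -> finite_set Z -> is_cover x Z -> (Z `&` xi)%classic !=set0.

End FiltersES.

Section Sanity.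
Context {d : Order.disp_t} {B : cbDistrLatticeType d} {L : eqType}.
Variable G : gbds B L.
Implicit Types (A C : B) (al be ga de : seq L).

Lemma word_act_cat al be A :
  word_act G (al ++ be) A = word_act G be (word_act G al A).
Proof. exact: foldl_cat. Qed.

Lemma word_act_le al A C : A <= C -> word_act G al A <= word_act G al C.
Proof.
elim: al A C => [|a al IH] A C //= AC; apply: IH.
have [mI _ _ _] := actP G a.
by rewrite leEmeet -mI; move: AC; rewrite leEmeet => /eqP ->.
Qed.

Lemma idl_le a A C : idl G a A -> C <= A -> idl G a C.
Proof.
by have [_ _ h] := idlP G a => /(h _ C) {}h; rewrite leEmeet meetC => /eqP <-.
Qed.

Lemma word_idl_le al A C : word_idl G al A -> C <= A -> word_idl G al C.
Proof.
case: al => [|a al] //= [D aD AD] CA; exists D => //.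
exact: le_trans CA AD.
Qed.

Lemma word_act_idl al be A :
  word_idl G al A -> word_idl G (al ++ be) (word_act G be A).
Proof.
case: al => [_|a al [D aD AD]] /=; last first.
  by exists D => //; rewrite word_act_cat word_act_le.
case: be => [|b be] //=; exists (act G b A) => //.
by apply: act_sub_idl; exists A.
Qed.

Lemma prod_valid (s t : triple) al A be :
  valid G s -> valid G t -> prod_triple G s t = Some (al, A, be) ->
  A <> \bot -> valid G (al, A, be).
Proof.
move: s t => [[al1 A1] be1] [[ga C] de] /asboolP[_ s1 s2] /asboolP[_ t1 t2] /=.
case: eqP => [_ [<- <- <-] nz|_].
  by apply/asboolP; split=> //; apply: word_idl_le; eauto; rewrite ?leIl ?leIr.
case: ifP => [_ [<- <- <-] nz|_].
  apply/asboolP; split=> //.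
    by apply: word_idl_le (leIl _ _); exact: word_act_idl.
  exact: word_idl_le t2 (leIr _ _).
case: ifP => [_ [<- <- <-] nz|_] //.
apply/asboolP; split=> //; first exact: word_idl_le s1 (leIl _ _).
by apply: word_idl_le (leIr _ _); exact: word_act_idl.
Qed.

Lemma smul_val (s t r : {t : triple | valid G t}) :
  smul (Some s) (Some t) = Some r -> prod_triple G (val s) (val t) = Some (val r).
Proof.
rewrite /smul; case: prod_triple => // -[[al A] be].
by rewrite /elt; case: insubP => //= u _ <- [->].
Qed.

Lemma ES_idem (e : isg G) : ES e <-> smul e e = e.
Proof.
have fix_nil (al x : seq L) : al ++ x = al -> x = [::].
  move=> /(congr1 size); rewrite size_cat => /eqP.
  by rewrite -{2}[size al]addn0 eqn_add2l size_eq0 => /eqP.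
case: e => [t|] //; split.
  case: t => [[[al A] be] v]; rewrite /ES /= => ?; subst be.
  by rewrite eqxx meetxx /elt insubT.
move=> /smul_val; rewrite /ES /=; case: (val t) => [[al A] be] /=.
case: eqP => // _; case: ifP => [/prefixP[x ->]|_].
  by rewrite drop_size_cat // => -[/fix_nil -> _]; rewrite cats0.
case: ifP => // /prefixP[x ->].
by rewrite drop_size_cat // => -[_ /fix_nil ->]; rewrite cats0.
Qed.

Lemma sle_prefix (s t : {t : triple | valid G t}) :
  ES (Some s) -> ES (Some t) -> sle (Some s) (Some t) ->
  prefix (val t).1.1 (val s).1.1.
Proof.
move=> es et /smul_val; move: es et; rewrite /ES /=.
case: s t => [[[al A] al'] ?] [[[ga C] ga'] ?] /= <- <-.
case: eqP => [-> _|_]; first exact: prefix_refl.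
case: ifP => [_ [_ _ ->]|_]; first exact: prefix_refl.
by case: ifP.
Qed.

Lemma Wstar_prefix al be A : A <> \bot -> word_idl G (al ++ be) A -> Wstar G al.
Proof.
case: al => [|a al] nz; rewrite /Wstar => + /seteqP[h _].
  by move=> _; exact/nz/h.
move=> [D aD AD]; apply: nz; apply/eqP; rewrite -lex0.
rewrite (le_trans AD) // word_act_cat (_ : word_act G al D = \bot); last first.
  by apply: h; exists D.
elim: be {AD} => //= b be IH; have [_ _ _ ->] := actP G b; exact: IH.
Qed.

Lemma first_entries_Wstar (xi : set (isg G)) al be :
  first_entries xi (al ++ be) -> Wstar G al.
Proof.
move=> [[[[ga A] de] v] _ /= ega]; subst ga.
by case/asboolP: v => nz h _; exact: Wstar_prefix nz h.
Qed.

Lemma first_entries_dir (xi : set (isg G)) al be :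
  filterES xi -> first_entries xi al -> first_entries xi be ->
  exists ga, [/\ first_entries xi ga, prefix al ga & prefix be ga].
Proof.
move=> [sub _ n0 _ dir] [s xs <-] [t xt <-].
have [[r|] [xr rs rt]] := dir _ _ xs xt => //.
exists (val r).1.1; split; first by exists r.
  by apply: sle_prefix => //; exact: sub.
by apply: sle_prefix => //; exact: sub.
Qed.

Lemma prefix_nth (x : L) al be i :
  prefix al be -> (i < size al)%N -> nth x al i = nth x be i.
Proof. by move=> /prefixP[c ->] h; rewrite nth_cat h. Qed.

Lemma assoc_word_ex (xi : set (isg G)) :
  filterES xi -> exists2 w, assoc_word xi w & Wle G w.
Proof.
move=> Fx.
have [al0 fal0] : first_entries xi !=set0.
  by case: Fx => _ [[t|] xt] // _ _ _; exists (val t).1.1, t.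
have [[n hn]|nb] :=
    pselect (exists n, forall be, first_entries xi be -> (size be <= n)%N).
  pose p := fun k => `[< exists2 be, first_entries xi be & size be = k >].
  have p_ex : exists k, p k by exists (size al0); apply/asboolP; exists al0.
  have p_le k : p k -> (k <= n)%N by move=> /asboolP[be + <-]; exact: hn.
  case: (ex_maxnP p_ex p_le) => k /asboolP[al fal <-] mx; exists (Fin al).
    by split=> // be fbe; apply: mx; apply/asboolP; exists be.
  by apply: (@first_entries_Wstar xi al [::]); rewrite ?cats0.
have big n : exists be, first_entries xi be /\ (n < size be)%N.
  apply: contrapT => h; apply: nb; exists n => be fbe.
  by rewrite leqNgt; apply/negP => nbe; apply: h; exists be.
have [e he] := choice big.
have [x _] : exists x : L, True.
  by have [_] := he 0; case: (e 0) => // x; exists x.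
pose u n := nth x (e n) n.
have uP be : first_entries xi be -> be = mkseq u (size be).
  move=> fbe; apply: (@eq_from_nth _ x); rewrite ?size_mkseq // => i ibe.
  have [fe ie] := he i.
  have [ga [_ ga1 ga2]] := first_entries_dir Fx fbe fe.
  by rewrite nth_mkseq // /u (prefix_nth _ ga1) // (prefix_nth _ ga2).
exists (Inf u) => //= n _; have [fe ne] := he n.
apply: (@first_entries_Wstar xi _ (drop n (e n))) => //.
suff -> : mkseq u n = take n (e n) by rewrite cat_take_drop.
by rewrite (uP _ fe) -map_take take_iota (minn_idPl (ltnW ne)).
Qed.

Lemma assoc_word_uniq (xi : set (isg G)) w w' :
  filterES xi -> assoc_word xi w -> assoc_word xi w' -> w = w'.
Proof.
move=> Fx; case: w w' => [al|u] [al'|u'] /=.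
- move=> [f m] [f' m']; congr Fin.
  have [ga [_ /prefixP[x gx] /prefixP[y gy]]] := first_entries_dir Fx f f'.
  have sz : size al = size al'.
    by apply/eqP; rewrite eqn_leq m ?m'.
  by move/eqP: gy; rewrite gx eqseq_cat // => /andP[/eqP].
- by move=> [_ m] [nb _]; case: nb; exists (size al).
- by move=> [nb _] [_ m]; case: nb; exists (size al').
move=> [nb h] [_ h']; congr Inf; apply/funext => n.
apply: contrapT => ne; apply: nb; exists n => be fbe.
rewrite leqNgt; apply/negP => nbe; apply: ne.
have := h' _ fbe; rewrite {1}(h _ fbe) => /(congr1 (nth (u n) ^~ n)).
by rewrite !nth_mkseq.
Qed.

End Sanity.

(* Main.v *)
Require Import Defs.
From mathcomp Require Import all_boot all_order.
From mathcomp Require Import boolp classical_sets functions cardinality.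

(* E(S) is a meet-semilattice, and (al, A, al) lies below (be, C, be) exactly
   when al = be ++ ga and A <= act ga C.  Ultrafilters in a semilattice with
   zero are tight.  Conversely, {D & A, D \ A} covers D, so every level of a
   tight filter is prime; this gives maximality of the last level, or of the
   whole filter if the associated word is infinite.  If A is regular, then
   finitely many idempotents (al b, act b A, al b), with b in Delta A, cover
   (al, A, al), so a tight filter containing (al, A, al) goes past al.  If A is
   not regular, take a nonzero C <= A with Delta C empty or infinite: no finite
   set of idempotents whose words go past al covers (al, C, al), since only
   finitely many b in Delta C occur as the next letter. *)

Set Implicit Arguments.
Unset Strict Implicit.
Unset Printing Implicit Defensive.

Import Order.Theory.

(** * Filters and ultrafilters in a poset with least element *)

Section FilterTheory.
Local Open Scope classical_set_scope.
Context {T : Type} {le : T -> T -> Prop} {bot : T} {P : set T}.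

(** Directedness merges finitely many witnesses into one, since each [R i] passes to smaller members
    of the filter. It is applied with [R] a disjointness condition against the members of a finite
    cover. *)
Lemma filter_lower_bound {I : eqType} (F : set T) (Z : set I)
    (R : I -> T -> Prop) :
  is_filter le bot P F -> finite_set Z ->
  (forall i y y', Z i -> F y -> F y' -> le y' y -> R i y -> R i y') ->
  (forall i, Z i -> exists2 y, F y & R i y) ->
  exists2 y, F y & forall i, Z i -> R i y.
Proof.
move=> [_ [y0 Fy0] _ _ dir] /finite_seqP[s ->].
elim: s => [|i s IH] Rle h; first by exists y0.
have js_is j : j \in s -> j \in i :: s by rewrite inE orbC => ->.
have [|j /js_is|y1 Fy1 Ry1] := IH; [|exact: h|].
  by move=> j y y' /js_is; exact: Rle.
have [y2 Fy2 Ry2] := h i (mem_head _ _).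
have [y [Fy yy1 yy2]] := dir _ _ Fy1 Fy2.
exists y => // j; rewrite /= inE => /orP[/eqP ->|js].
  exact: Rle (mem_head _ _) Fy2 Fy yy2 Ry2.
exact: Rle (js_is _ js) Fy1 Fy yy1 (Ry1 j js).
Qed.

(** The upward closure [F'] of all [m z x] with [z] in [F] is a filter containing [F] and [x], so
    maximality gives [F' = F]. The operation [m] only has to act as a meet with [x] on [P], which
    serves both [ES] and the ideals [word_idl G al]. *)
Lemma ultrafilter_mem (m : T -> T -> T) (F : set T) (x : T) :
  (forall y z t, P y -> P z -> P t -> le y z -> le z t -> le y t) ->
  (forall y, P y -> le y bot -> y = bot) ->
  (forall y, P y -> [/\ P (m y x), le (m y x) y & le (m y x) x]) ->
  (forall y t, P y -> P t -> le t y -> le t x -> le t (m y x)) ->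
  is_ultrafilter le bot P F -> P x ->
  (forall y, F y -> m y x <> bot) -> F x.
Proof.
move=> tr le0 mP glb [[FP [y0 Fy0] F0 up dir] mx] Px mn.
pose F' := [set y | P y /\ exists2 z, F z & le (m z x) y].
have P0y y : F y -> P (m y x) by move=> /FP/mP[].
suff -> : F = F' by split=> //; exists y0 => //; have [] := mP _ (FP _ Fy0).
apply/esym; apply: mx; last first.
  by move=> y Fy; split; [exact: FP|exists y => //; have [] := mP _ (FP _ Fy)].
split.
- by move=> y [].
- by exists y0; split; [exact: FP|exists y0 => //; have [] := mP _ (FP _ Fy0)].
- by move=> [_ [z Fz /le0]] => /(_ (P0y _ Fz)); exact: mn.
- move=> y t [Py [z Fz zy]] Pt yt; split=> //; exists z => //.
  exact: tr (P0y _ Fz) Py Pt zy yt.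
move=> y t [Py [z Fz zy]] [Pt [z' Fz' zt]].
have [r [Fr rz rz']] := dir _ _ Fz Fz'.
have [Pm mr mxx] := mP _ (FP _ Fr).
have low s : F s -> le r s -> le (m r x) (m s x).
  move=> Fs rs; apply: glb => //; first exact: FP.
  by apply: tr mr rs => //; exact: FP.
exists (m r x); split.
- split=> //; exists r => //; apply: glb => //; exact: FP.
- exact: tr Pm (P0y _ Fz) Py (low _ Fz rz) zy.
exact: tr Pm (P0y _ Fz') Pt (low _ Fz' rz') zt.
Qed.

End FilterTheory.

(** * Products and order of idempotents *)

Section Idempotents.
Local Open Scope classical_set_scope.
Local Open Scope order_scope.
Context {d : Order.disp_t} {B : cbDistrLatticeType d} {L : eqType}.
Variable G : gbds B L.
Implicit Types (A C D E : B) (al be ga : seq L) (e f g : isg G).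

Notation act ga := (word_act G ga).

Lemma word_actP ga : is_action (act ga).
Proof.
elim: ga => [|a ga [hI hU hD h0]]; first by [].
have [aI aU aD a0] := actP G a.
by split=> [A C|A C|A C|] /=; rewrite ?(aI, aU, aD, a0).
Qed.

Lemma word_actI ga A C : act ga (A `&` C) = act ga A `&` act ga C.
Proof. by have [] := word_actP ga. Qed.

Lemma word_actU ga A C : act ga (A `|` C) = act ga A `|` act ga C.
Proof. by have [] := word_actP ga. Qed.

Lemma word_act0 ga : act ga \bot = \bot.
Proof. by have [] := word_actP ga. Qed.

(** Being total, with value zero on invalid entries, it lets product formulas such as
    [smul_idem_cat] hold without a separate case for an empty middle entry. *)
Definition idem al A : isg G := elt G al A al.

Lemma neq_bot_le A C : A <= C -> A <> \bot -> C <> \bot.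
Proof. by move=> AC A0 C0; apply: A0; apply/eqP; rewrite -lex0 -C0. Qed.

Lemma idem_bot al : idem al \bot = None.
Proof. by rewrite /idem /elt insubF //; apply/asboolP => -[]. Qed.

Lemma idem_neq0 al A : idem al A <> None <-> A <> \bot /\ word_idl G al A.
Proof.
rewrite /idem /elt; case: insubP => [u /asboolP[] //|nv].
by split=> // -[A0 iA]; case/asboolP: nv.
Qed.

Lemma idemE al A (A0 : A <> \bot) (iA : word_idl G al A) :
  exists2 v, idem al A = Some v & val v = (al, A, al).
Proof.
rewrite /idem /elt; case: insubP => [v _ ve|/asboolP[]//].
by exists v.
Qed.

Lemma ES_idem al A : ES (idem al A).
Proof.
have [[A0 iA]|/idem_neq0] := pselect (A <> \bot /\ word_idl G al A).
  by have [v -> ve] := idemE A0 iA; rewrite /ES /= ve.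
by move=> /contrapT ->.
Qed.

Lemma ES_inv e : ES e -> e <> None ->
  exists al A, [/\ A <> \bot, word_idl G al A & e = idem al A].
Proof.
case: e => [[[[al A] be] v]|] // + _; rewrite /ES /= => ?; subst be.
exists al, A; case/asboolP: (v) => A0 iA _; split=> //.
by rewrite /idem /elt insubT.
Qed.

Lemma idem_inj al be A C : A <> \bot -> word_idl G al A ->
  idem al A = idem be C -> al = be /\ A = C.
Proof.
move=> A0 iA eAC; have /idem_neq0[C0 iC] : idem be C <> None.
  by rewrite -eAC; apply/idem_neq0.
have [v ev vE] := idemE A0 iA; have [w ew wE] := idemE C0 iC.
by move: eAC; rewrite ev ew => -[/(congr1 val)]; rewrite vE wE => -[-> ->].
Qed.

Lemma smul_idem_cat al ga A C : word_idl G al A -> word_idl G (al ++ ga) C ->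
  smul (idem al A) (idem (al ++ ga) C) = idem (al ++ ga) (act ga A `&` C).
Proof.
move=> iA iC.
have [->|A0] := pselect (A = \bot); first by rewrite word_act0 meet0x !idem_bot.
have [->|C0] := pselect (C = \bot).
  by rewrite meetx0 !idem_bot; case: (idem al A).
have [v -> vE] := idemE A0 iA; have [w -> wE] := idemE C0 iC.
rewrite /smul vE wE /=; case: eqP => [e|_].
  have /nilP -> : nilp ga.
    move/(congr1 size)/eqP: e.
    by rewrite size_cat -{1}[size al]addn0 eqn_add2l eq_sym.
  by rewrite cats0.
by rewrite prefix_prefix drop_size_cat.
Qed.

Lemma smulC e f : ES e -> ES f -> smul e f = smul f e.
Proof.
case: e f => [[[[al A] al'] v]|] [[[[be C] be'] w]|] //.
rewrite /ES /= => ? ?; subst al' be'.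
rewrite [be == al]eq_sym; case: eqVneq => [->|ne]; first by rewrite meetC.
case: ifP => [/prefixP[x ex]|_]; case: ifP => [/prefixP[y ey]|_] //.
(* Two words that are beginnings of each other coincide, against [ne]. *)
- have := congr1 size ex; rewrite ey !size_cat -addnA => /eqP.
  rewrite -{1}[size be]addn0 eqn_add2l eq_sym addn_eq0 => /andP[/nilP y0 _].
  by move: ne; rewrite ey y0 cats0 eqxx.
- by rewrite ex drop_size_cat // meetC.
- by rewrite ey drop_size_cat // meetC.
Qed.

(** A non-zero product forces the two words to be comparable. The disjunction records which factor
    has the shorter word, so that later case analyses start from this normal form. *)
Lemma smul_neq0 e f : ES e -> ES f -> smul e f <> None ->
  exists al ga A C, [/\ word_idl G al A, word_idl G (al ++ ga) C,
    act ga A `&` C <> \bot /\ word_idl G (al ++ ga) (act ga A `&` C),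
    smul e f = idem (al ++ ga) (act ga A `&` C) &
    (e = idem al A /\ f = idem (al ++ ga) C) \/
    (f = idem al A /\ e = idem (al ++ ga) C)].
Proof.
move=> Ee Ef n0.
have e0 : e <> None by move=> e0; apply: n0; rewrite e0.
have f0 : f <> None by move=> f0; apply: n0; rewrite f0; case: (e).
have [al [A [A0 iA eE]]] := ES_inv Ee e0.
have [be [C [C0 iC fE]]] := ES_inv Ef f0.
have [/prefixP[ga bE]|npab] := boolP (prefix al be).
  subst be; have sE : smul e f = idem (al ++ ga) (act ga A `&` C).
    by rewrite eE fE smul_idem_cat.
  exists al, ga, A, C; split=> //; last by left.
  by apply/idem_neq0; rewrite -sE.
have [/prefixP[ga aE]|npba] := boolP (prefix be al).
  subst al; have sE : smul e f = idem (be ++ ga) (act ga C `&` A).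
    by rewrite smulC // eE fE smul_idem_cat.
  exists be, ga, C, A; split=> //; last by right.
  by apply/idem_neq0; rewrite -sE.
case: n0; have [v vE ve] := idemE A0 iA; have [w wE we] := idemE C0 iC.
rewrite eE fE vE wE /smul ve we /= (negbTE npab) (negbTE npba).
by case: eqP => // ab; rewrite ab prefix_refl in npab.
Qed.

Lemma sle_idemP al be A C :
  A <> \bot -> word_idl G al A -> word_idl G be C ->
  sle (idem al A) (idem be C) <-> exists2 ga, al = be ++ ga & A <= act ga C.
Proof.
move=> A0 iA iC; split=> [le|[ga ? AC]]; last first.
  subst al; rewrite /sle smulC; [|exact: ES_idem..].
  by rewrite smul_idem_cat //; congr idem; apply/meet_idPr.
have n0 : smul (idem al A) (idem be C) <> None by rewrite le; apply/idem_neq0.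
have [de [ga [D [E [iD iE [DE0 iDE] sE]]]]] :=
  smul_neq0 (ES_idem _ _) (ES_idem _ _) n0.
move: le; rewrite /sle sE => /(idem_inj DE0 iDE)[dA EA].
have C0 : C <> \bot.
  by move=> C0; apply: n0; rewrite C0 idem_bot; case: (idem al A).
(* If [al] is the shorter word, both words agree, because the product has the longer word and equals
   [idem al A]. *)
case=> -[/idem_inj] => [/(_ A0 iA)|/(_ C0 iC)] [? ?] /idem_inj.
  move=> /(_ C0 iC)[bE CE]; exists [::]; first by rewrite cats0 bE dA.
  by rewrite -EA CE leIr.
move=> _; subst de D; exists ga; first by rewrite dA.
by rewrite -EA leIl.
Qed.

Lemma sle0 e : ES e -> sle e None -> e = None.
Proof. by case: e. Qed.

Lemma sle_trans e f g : ES e -> ES f -> ES g -> sle e f -> sle f g -> sle e g.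
Proof.
move=> Ee Ef Eg ef fg.
have [->//|e0] := pselect (e = None).
have f0 : f <> None by move=> f0; rewrite f0 in ef; apply/e0/sle0.
have g0 : g <> None by move=> g0; rewrite g0 in fg; apply/f0/sle0.
have [al [A [A0 iA eE]]] := ES_inv Ee e0.
have [be [C [C0 iC fE]]] := ES_inv Ef f0.
have [ga [D [D0 iD gE]]] := ES_inv Eg g0.
subst; move/sle_idemP: ef => -[] // x xE AC.
move/sle_idemP: fg => -[] // y yE CD.
apply/sle_idemP => //; exists (y ++ x); first by rewrite xE yE catA.
by rewrite word_act_cat (le_trans AC) // word_act_le.
Qed.

Lemma smul_meet e f : ES e -> ES f ->
  [/\ ES (smul e f), sle (smul e f) e & sle (smul e f) f].
Proof.
move=> Ee Ef; have [->//|n0] := pselect (smul e f = None).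
have [al [ga [A [C [iA iC [n iAC] -> efE]]]]] := smul_neq0 Ee Ef n0.
have l1 : sle (idem (al ++ ga) (act ga A `&` C)) (idem al A).
  by apply/sle_idemP => //; exists ga => //; rewrite leIl.
have l2 : sle (idem (al ++ ga) (act ga A `&` C)) (idem (al ++ ga) C).
  by apply/sle_idemP => //; exists [::]; rewrite ?cats0 //= leIr.
by case: efE => -[-> ->]; split=> //; exact: ES_idem.
Qed.

Lemma cat_comparable (s1 s2 t1 t2 : seq L) : s1 ++ t1 = s2 ++ t2 ->
  prefix s1 s2 \/ prefix s2 s1.
Proof.
move=> e.
have h (a b x y : seq L) :
    a ++ x = b ++ y -> (size a <= size b)%N -> prefix a b.
  move=> /(congr1 (take (size a))); rewrite take_size_cat // => + sz.
  by rewrite takel_cat // prefixE => <-.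
have [sz|/ltnW sz] := leqP (size s1) (size s2); [left|right].
  exact: h e sz.
exact: h (esym e) sz.
Qed.

(** The words of [e] and [f] are both beginnings of the word of [g], hence comparable. By
    commutativity the first may be taken as the shorter one, and then the claim follows because word
    actions preserve meets. *)
Lemma sle_smul e f g : ES e -> ES f -> ES g -> sle g e -> sle g f ->
  sle g (smul e f).
Proof.
move=> Ee Ef Eg; have [->//|g0] := pselect (g = None).
have [de [D [D0 iD gE]]] := ES_inv Eg g0.
have low h : ES h -> sle g h -> exists al x A,
    [/\ A <> \bot, word_idl G al A, h = idem al A, de = al ++ x & D <= act x A].
  move=> Eh gh; have h0 : h <> None.
    by move=> h0; rewrite h0 in gh; apply/g0/sle0.
  have [al [A [A0 iA hE]]] := ES_inv Eh h0.
  move: gh; rewrite gE hE => /sle_idemP[]// x dE DA.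
  by exists al, x, A.
move=> /(low _ Ee)[al [x [A [A0 iA eE dx DA]]]].
move=> /(low _ Ef)[be [y [C [C0 iC fE dy DC]]]].
suff key a b u v (A1 C1 : B) :
    prefix a b -> word_idl G a A1 -> word_idl G b C1 ->
    de = a ++ u -> D <= act u A1 -> de = b ++ v -> D <= act v C1 ->
    sle g (smul (idem a A1) (idem b C1)).
  have [ab|ba] := @cat_comparable al be x y (etrans (esym dx) dy).
    by rewrite eE fE; exact: key dx DA dy DC.
  rewrite smulC // eE fE; exact: key dy DC dx DA.
move=> /prefixP[t ->] ia ib du Du dv Dv; rewrite smul_idem_cat // gE.
(* Both [a ++ u] and [a ++ t ++ v] spell the word of [g]; cancel [a]. *)
have tv : u = t ++ v.
  by move/eqP: dv; rewrite du -catA eqseq_cat // eqxx => /eqP.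
apply/sle_idemP => //; first exact: word_idl_le ib (leIr _ _).
exists v => //; rewrite word_actI lexI Dv andbT.
by rewrite -word_act_cat -tv.
Qed.

End Idempotents.

(** * Filters in E(S), their levels, and tightness *)

Section TightFilters.
Local Open Scope classical_set_scope.
Local Open Scope order_scope.
Context {d : Order.disp_t} {B : cbDistrLatticeType d} {L : eqType}.
Variable G : gbds B L.
Implicit Types (A C D E : B) (al be ga : seq L) (e f g : isg G).
Implicit Types (xi : set (isg G)).

Notation act ga := (word_act G ga).
Notation idem := (@idem _ _ _ G).

Lemma filterES_inv xi e : filterES xi -> xi e ->
  exists al A, [/\ A <> \bot, word_idl G al A & e = idem al A].
Proof.
move=> [sub _ n0 _ _] xe; apply: ES_inv; first exact: sub.
by move=> e0; apply: n0; rewrite -e0.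
Qed.

Lemma filterES_idem xi al A : filterES xi -> xi (idem al A) ->
  A <> \bot /\ word_idl G al A.
Proof. by move=> [_ _ n0 _ _] xA; apply/idem_neq0 => e; rewrite e in xA. Qed.

Lemma filterES_smul xi e f : filterES xi -> xi e -> xi f -> xi (smul e f).
Proof.
move=> [sub _ _ up dir] xe xf; have [z [xz ze zf]] := dir _ _ xe xf.
have [Ee Ef Ez] : [/\ ES e, ES f & ES z] by split; exact: sub.
by apply: up xz _ _; [have [] := smul_meet Ee Ef|exact: sle_smul].
Qed.

Lemma filterES_cat xi al ga A C : filterES xi ->
  xi (idem al A) -> xi (idem (al ++ ga) C) ->
  xi (idem (al ++ ga) (act ga A `&` C)).
Proof.
move=> Fx xA xC; rewrite -smul_idem_cat; first exact: filterES_smul.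
  by have [] := filterES_idem Fx xA.
by have [] := filterES_idem Fx xC.
Qed.

Lemma filterES_up xi al ga A C : filterES xi -> word_idl G al C ->
  A <= act ga C -> xi (idem (al ++ ga) A) -> xi (idem al C).
Proof.
move=> Fx iC lAC xA; have [A0 iA] := filterES_idem Fx xA.
case: Fx => _ _ _ up _; apply: up xA (ES_idem _ _ _) _.
by apply/sle_idemP => //; exists ga.
Qed.

Lemma first_entriesP xi al : filterES xi ->
  first_entries xi al <-> exists A, xi (idem al A).
Proof.
move=> Fx; split=> [[t xt <-]|[A xA]].
  have [be [A [A0 iA eA]]] := filterES_inv Fx xt.
  have [v vE ve] := idemE A0 iA; move: eA; rewrite vE => -[tv].
  by exists A; rewrite tv ve /= vE -tv.
have [A0 iA] := filterES_idem Fx xA; have [v vE ve] := idemE A0 iA.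
by exists v; rewrite -?vE // ve.
Qed.

(** A common extension of [al] and [be] among the first entries cannot be longer than [al], so it is
    [al] itself. *)
Lemma first_entries_prefix xi al be : filterES xi ->
  assoc_word xi (Fin al) -> first_entries xi be -> prefix be al.
Proof.
move=> Fx [fal mx] fbe.
have [ga [fga /prefixP[x gE] pb]] := first_entries_dir Fx fal fbe.
have := mx _ fga; rewrite gE size_cat -{2}[size al]addn0 leq_add2l leqn0.
by move=> /nilP x0; rewrite gE x0 cats0 in pb.
Qed.

Lemma levelE xi al : filterES xi ->
  level xi (Fin al) (size al) = [set A | xi (idem al A)].
Proof.
move=> Fx; apply/seteqP; rewrite /level /= take_size; split=> A; first by case.
by move=> xA; split=> //; have [] := filterES_idem Fx xA.
Qed.

Lemma level_filter xi al : filterES xi -> first_entries xi al ->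
  is_filter (fun A C : B => A <= C) \bot (word_idl G al)
    [set A | xi (idem al A)].
Proof.
move=> Fx /(first_entriesP _ Fx) fal; split=> //=.
- by move=> A /(filterES_idem Fx)[].
- by move=> /(filterES_idem Fx)[].
- move=> A C xA iC lAC; apply: (filterES_up (ga := [::]) Fx iC lAC).
  by rewrite cats0.
move=> A C xA xC; exists (A `&` C); rewrite leIl leIr; split=> //.
have := @filterES_cat xi al [::] A C Fx xA; rewrite cats0; exact.
Qed.

Lemma sle_idem_le al A C : word_idl G al C -> A <= C ->
  sle (idem al A) (idem al C).
Proof.
move=> iC lAC; have [->|A0] := pselect (A = \bot); first by rewrite idem_bot.
apply/sle_idemP => //; first exact: word_idl_le lAC.
by exists [::]; rewrite ?cats0.
Qed.

Lemma smul_cat_neq0 al ga A C : word_idl G al A -> word_idl G (al ++ ga) C ->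
  act ga A `&` C <> \bot -> smul (idem (al ++ ga) C) (idem al A) <> None.
Proof.
move=> iA iC n0; rewrite smulC; [|exact: ES_idem..].
rewrite smul_idem_cat //; apply/idem_neq0; split=> //.
exact: word_idl_le (leIr _ _).
Qed.

Lemma tight_split xi al A D : is_tight xi -> xi (idem al D) ->
  xi (idem al (D `&` A)) \/ xi (idem al (D `\` A)).
Proof.
move=> [Fx tx] xD; have [D0 iD] := filterES_idem Fx xD.
pose Z := [set idem al (D `&` A); idem al (D `\` A)].
suff cZ : is_cover (idem al D) Z.
  by have [_ [[]-> xz]] := tx _ _ xD (finite_set2 _ _) cZ; [left|right].
split=> [_ [] -> /=|y Ey y0 yD].
- by split; [exact: ES_idem|apply: sle_idem_le; rewrite ?leIl].
- by split; [exact: ES_idem|apply: sle_idem_le; rewrite ?leBx].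
have [be [E [E0 iE yE]]] := ES_inv Ey y0.
move: yD; rewrite yE => /sle_idemP[]// ga bE ED; subst be.
have [EA|EA] := pselect (act ga (D `&` A) `&` E = \bot); last first.
  exists (idem al (D `&` A)); first by left.
  by apply: smul_cat_neq0 EA => //; exact: word_idl_le (leIl _ _).
exists (idem al (D `\` A)); first by right.
apply: smul_cat_neq0 => //; first exact: word_idl_le (leBx _ _).
move=> EB; apply: E0.
(* The action carries the splitting of [D] to a splitting of [act ga D], which contains [E]; so [E]
   cannot miss both parts. *)
have : act ga D `&` E = E by apply/meet_idPr.
by rewrite -{1}[D](joinIB A) word_actU meetUl EA EB join0x => ->.
Qed.

Lemma ultrafilterES_mem xi e : ultrafilterES xi -> ES e ->
  (forall f, xi f -> smul f e <> None) -> xi e.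
Proof.
move=> Ux Ee h; apply: (ultrafilter_mem _ _ _ _ Ux Ee h).
- exact: sle_trans.
- exact: sle0.
- by move=> f Ef; exact: smul_meet.
by move=> f g Ef Eg; exact: sle_smul.
Qed.

Lemma ultrafilter_idl_mem al F A : ultrafilter_idl G al F -> word_idl G al A ->
  (forall C, F C -> C `&` A <> \bot) -> F A.
Proof.
move=> UF iA h; apply: (ultrafilter_mem _ _ _ _ UF iA h).
- by move=> x y z _ _ _; exact: le_trans.
- by move=> x _; rewrite lex0 => /eqP.
- by move=> x ix; rewrite leIl leIr; split=> //; exact: word_idl_le (leIl _ _).
by move=> x y _ _ yx yA; rewrite lexI yx.
Qed.

(** If the ultrafilter misses [Z], maximality makes each member of [Z] orthogonal to some element of
    [xi]. A common lower bound [y] of these elements is orthogonal to all of [Z]; then [smul y x] is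
    non-zero, lies below [x] and meets no member of the cover. *)
Lemma ultrafilter_tight xi : ultrafilterES xi -> is_tight xi.
Proof.
move=> Ux; have [Fx _] := Ux; split=> // x Z xx fZ [ZE cZ].
have [sub _ n0 up dir] := Fx; have Ex := sub _ xx.
apply: contrapT => Z0.
have [||y xy yZ] := @filter_lower_bound _ _ _ _ _ xi Z
    (fun z y => smul y z = None) Fx fZ.
- move=> z y y' /ZE[Ez _] xy xy' y'y yz; apply: sle0.
    by have [] := smul_meet (sub _ xy') Ez.
  have [Em my mz] := smul_meet (sub _ xy') Ez.
  rewrite -yz; apply: sle_smul => //; first exact: sub.
  by apply: sle_trans my y'y => //; exact: sub.
- move=> z Zz; apply: contrapT => h; apply: Z0; exists z; split=> //.
  apply: ultrafilterES_mem => //; first by have [] := ZE z Zz.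
  by move=> f xf fz; apply: h; exists f.
have [Em my mx] := smul_meet (sub _ xy) Ex.
have xm := filterES_smul Fx xy xx.
have m0 : smul y x <> None by move=> m0; rewrite m0 in xm.
have [z Zz] := cZ _ Em m0 mx; apply.
have Ez : ES z by have [] := ZE z Zz.
have [Emz mzm mzz] := smul_meet Em Ez.
apply: sle0 => //; rewrite -(yZ _ Zz); apply: sle_smul => //.
  exact: sub.
by apply: sle_trans mzm my => //; exact: sub.
Qed.

(** An element of a larger filter [F'] has some word [be], and [xi] has an element with a word at
    least as long, necessarily extending [be]. Moving the entry up to that word and splitting there
    decides membership in [xi]. *)
Lemma tight_infinite_ultrafilter xi : is_tight xi -> infinite_type xi ->
  ultrafilterES xi.
Proof.
move=> tx [u [nb hu]]; have [Fx _] := tx; split=> // F' F'F sF.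
apply/seteqP; split=> // e F'e.
have [be [A [A0 iA eA]]] := filterES_inv F'F F'e; rewrite {}eA in F'e *.
have [al fal sz] : exists2 al, first_entries xi al & (size be <= size al)%N.
  apply: contrapT => h; apply: nb; exists (size be) => ga fga.
  by rewrite leqNgt; apply/negP => /ltnW sz; apply: h; exists ga.
have [D xD] := (first_entriesP _ Fx).1 fal.
have [ga aE] : exists ga, al = be ++ ga.
  have fbe : first_entries F' be by apply/first_entriesP => //; exists A.
  have fal' : first_entries F' al.
    by apply/first_entriesP => //; exists D; exact: sF.
  have [de [_ /prefixP[s ->] /prefixP[t]]] := first_entries_dir F'F fbe fal'.
  (* Both words begin a common word and [be] is not longer than [al], so the first [size be] letters
     of [al] are [be]. *)
  move=> /(congr1 (take (size be))).
  rewrite take_size_cat // takel_cat // => bE.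
  by exists (drop (size be) al); rewrite {1}bE cat_take_drop.
subst al; have [xA|xA] := tight_split (act ga A) tx xD.
  exact: filterES_up Fx iA (leIr _ _) xA.
(* The part outside [act ga A] would have zero product with [idem be A], although both lie in
   [F']. *)
have := filterES_cat F'F F'e (sF _ xA).
by rewrite diffKI => /(filterES_idem F'F)[].
Qed.

(** For [A] in a larger filter [F'], the level contains the part of [D] inside or outside [A]. The
    first puts [A] in the level; the second is disjoint from [A], which is impossible within
    [F']. *)
Lemma tight_finite_ultrafilter xi al : is_tight xi ->
  first_entries xi al -> ultrafilter_idl G al [set A | xi (idem al A)].
Proof.
move=> tx fal; have [Fx _] := tx; split; first exact: level_filter.
move=> F' [F'i _ F'0 _ dir] sF; apply/seteqP; split=> // A F'A.
have [D xD] := (first_entriesP _ Fx).1 fal.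
have [xA|xA] := tight_split A tx xD.
  have := @filterES_up xi al [::] _ A Fx (F'i _ F'A) (leIr A D).
  by rewrite cats0; apply.
have [C [F'C CA CD]] := dir _ _ F'A (sF _ xA).
have : C <= A `&` (D `\` A) by rewrite lexI CA.
by rewrite diffKI lex0 => /eqP C0; rewrite C0 in F'C.
Qed.

Lemma tight_finite_nonregular xi al A : is_tight xi -> assoc_word xi (Fin al) ->
  xi (idem al A) -> ~ regular G A.
Proof.
move=> [Fx tx] aw xA regA; have [A0 iA] := filterES_idem Fx xA.
have [_ finA] := regA A A0 (lexx _).
pose Z := [set idem (al ++ [:: b]) (act [:: b] A) | b in Delta G A].
have ib be : word_idl G (al ++ be) (act be A) by exact: word_act_idl.
suff cZ : is_cover (idem al A) Z.
  have [_ [[b _ <-] xb]] := tx _ _ xA (finite_image _ finA) cZ.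
  have [_ mx] := aw; have /mx : first_entries xi (al ++ [:: b]).
    by apply/first_entriesP => //; exists (act [:: b] A).
  by rewrite size_cat addn1 ltnn.
split=> [_ [b Ab <-]|y Ey y0 yA].
  split; first exact: ES_idem.
  by apply/sle_idemP => //; exists [:: b].
have [be [E [E0 iE yE]]] := ES_inv Ey y0.
move: yA; rewrite yE => /sle_idemP[]// ga bE EA; subst be.
(* If [y] has the word [al], regularity supplies a letter [b] that does not kill [E]. Otherwise [b]
   is the letter of [y] following [al], and it lies in [Delta G A] because [E] is non-zero. *)
case: ga => [|b ga] in iE EA {y Ey y0 yE} *.
  rewrite cats0 in iE *; have [[b Eb] _] := regA E E0 EA.
  have bEA : act [:: b] E <= act [:: b] A by exact: word_act_le.
  exists (idem (al ++ [:: b]) (act [:: b] A)).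
    by exists b => //; exact: neq_bot_le bEA Eb.
  rewrite smul_idem_cat //; move/meet_idPl: bEA => ->.
  by apply/idem_neq0; split=> //; exact: word_act_idl.
exists (idem (al ++ [:: b]) (act [:: b] A)).
  exists b => // bA0; apply: E0; apply/eqP; rewrite -lex0.
  by move: EA; rewrite -cat1s word_act_cat [act [:: b] A]bA0 word_act0.
rewrite -cat1s catA in iE *; apply: smul_cat_neq0 => //.
by rewrite -word_act_cat; move/meet_idPr: EA => ->.
Qed.

(** A finite cover [Z] missing [xi] is refuted below a small [D] of the last level: members of [Z]
    with words beginning [al] are disjoint from [D], and the others expose only finitely many
    letters after [al]. *)
Lemma nonregular_tight xi al : filterES xi -> assoc_word xi (Fin al) ->
  ultrafilter_idl G al [set A | xi (idem al A)] ->
  (forall A, xi (idem al A) -> ~ regular G A) -> is_tight xi.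
Proof.
move=> Fx aw UF nreg; split=> // x Z xx fZ [ZE cZ].
apply: contrapT => Z0; have [sub _ n0 up dir] := Fx.
have [be [A [A0 iA xE]]] := filterES_inv Fx xx.
have /(first_entries_prefix Fx aw)/prefixP[s aE] : first_entries xi be.
  by apply/first_entriesP => //; exists A; rewrite -xE.
have [fal _] := aw; have [D0 xD0] := (first_entriesP _ Fx).1 fal.
(* When the word of [z] is a beginning of [al], the entry of [z] carried to [al] is disjoint from
   [D]. Quantifying over all presentations of [z] makes the condition vacuous for the other
   words. *)
pose R z D := forall ga s C, word_idl G ga C -> z = idem ga C ->
  al = ga ++ s -> act s C `&` D = \bot.
have [||D1 xD1 RD1] := @filter_lower_bound _ _ _ _ _ [set A | xi (idem al A)] Z
    R (level_filter Fx fal) fZ.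
- move=> z C C' _ _ _ C'C RC ga t E iE zE aE'; apply/eqP.
  by rewrite -lex0 -(RC _ _ _ iE zE aE') leI2.
- move=> z Zz; apply: contrapT => h.
  have [[ga [t [C [iC zC aC]]]]|nz] := pselect (exists ga t C,
      [/\ word_idl G ga C, z = idem ga C & al = ga ++ t]); last first.
    apply: h; exists D0 => // ga t C iC zC aC; case: nz.
    by exists ga, t, C.
  (* If no [D] of the level is disjoint from the entry carried to [al], that entry belongs to the
     level by maximality, and upward closure puts [z] in [xi]. *)
  apply: Z0; exists z; split=> //.
  rewrite zC; apply: (@filterES_up _ ga t (act t C)) => //; rewrite -aC.
  apply: (ultrafilter_idl_mem UF); first by rewrite aC; exact: word_act_idl.
  move=> D xD DC; apply: h; exists D => // ga' t' C' iC' zC' aC'.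
  have [z0|zn] := pselect (C' = \bot); first by rewrite z0 word_act0 meet0x.
  have [? ?] := idem_inj zn iC' (etrans (esym zC') zC); subst ga' C'.
  have -> : t' = t.
    by move/eqP: aC'; rewrite aC eqseq_cat // eqxx => /eqP.
  by rewrite meetC.
(* The meet with [act s A] places everything at or past [al] that comes from [D] below [x], where
   the cover applies. *)
pose D := D1 `&` act s A.
have xsA : xi (idem al D).
  have := @filterES_cat xi be s A D1 Fx; rewrite -aE -xE meetC.
  exact.
have Dx C : word_idl G al C -> C <> \bot -> C <= D ->
    forall ga, sle (idem (al ++ ga) (act ga C)) x.
  move=> iC C0 CD ga.
  have [->|gC0] := pselect (act ga C = \bot); first by rewrite idem_bot.
  rewrite xE; apply/sle_idemP => //; first exact: word_act_idl.
  exists (s ++ ga); first by rewrite aE catA.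
  by rewrite word_act_cat word_act_le // (le_trans CD) // leIr.
have [_ iD] := filterES_idem Fx xsA.
have [C [CD C0 Cinf]] : exists C, [/\ C <= D, C <> \bot &
    ~ (Delta G C !=set0 /\ finite_set (Delta G C))].
  apply: contrapT => h; apply: (nreg _ xsA) => C C0 CD.
  by apply: contrapT => nC; apply: h; exists C.
have iC : word_idl G al C := word_idl_le iD CD.
have CD1 : C <= D1 by exact: le_trans CD (leIl _ _).
(* Members of [Z] whose first entry is a beginning of [al] are disjoint from
   [D1], so a member of [Z] meeting an element below [C] goes past [al]. *)
have key ga : act ga C <> \bot -> exists c t E,
    [/\ Z (idem (al ++ c :: t) E), idem (al ++ c :: t) E <> None, Delta G C c &
        if ga is b :: _ then b = c else True].
  move=> gC0; have iy : word_idl G (al ++ ga) (act ga C) by exact: word_act_idl.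
  have y0 : idem (al ++ ga) (act ga C) <> None by apply/idem_neq0.
  have Ey := ES_idem G (al ++ ga) (act ga C).
  have [z Zz yz] := cZ _ Ey y0 (Dx _ iC C0 CD ga).
  have [Ez _] := ZE _ Zz.
  have z0 : z <> None.
    by move=> z0; rewrite z0 in yz; apply: yz; case: (idem _ _).
  have [be' [E [E0 iE zE]]] := ES_inv Ez z0.
  (* The longer of the two words is written in both ways; in each case [p] or [q] is empty. *)
  have [p [q [pq EC]]] : exists p q, be' ++ p = al ++ ga ++ q /\
      act p E `&` act (ga ++ q) C <> \bot.
    have [de [r [E1 [E2 [iE1 iE2 [n _] _]]]]] := smul_neq0 Ey Ez yz.
    rewrite zE => -[] [].
      move=> /(idem_inj gC0 iy)[? ?] /(idem_inj E0 iE)[? ?]; subst.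
      exists [::], r; rewrite cats0 catA; split=> //.
      by rewrite word_act_cat meetC.
    move=> /(idem_inj E0 iE)[? ?] /(idem_inj gC0 iy)[? ?]; subst.
    by exists r, [::]; rewrite cats0.
  (* The first two cases, where the word of [z] is a beginning of [al] or [al] itself, contradict
     disjointness from [D1]; in the third, [c] is the next letter after [al]. *)
  have [/prefixP[r aE']|/prefixP[[|c t] bE]] := cat_comparable pq.
  - case: EC; move/eqP: pq; rewrite aE' -catA eqseq_cat // eqxx /= => /eqP ->.
    rewrite word_act_cat -word_actI.
    suff -> : act r E `&` C = \bot by rewrite word_act0.
    by apply/eqP; rewrite -lex0 -(RD1 _ Zz _ _ _ iE zE aE') leI2.
  - case: EC; rewrite cats0 in bE; subst be'.
    move/eqP: pq; rewrite eqseq_cat // eqxx /= => /eqP ->.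
    rewrite -word_actI.
    suff -> : E `&` C = \bot by rewrite word_act0.
    apply/eqP; rewrite -lex0 -(RD1 _ Zz al [::] _ iE zE) ?cats0 //.
    by rewrite leI2.
  subst be'; move/eqP: pq; rewrite -catA eqseq_cat // eqxx /= => /eqP pq.
  exists c, t, E; rewrite -zE; split=> //; last by case: (ga) pq => // b ? [->].
  move=> /= cC0; apply: EC; rewrite -pq /=.
  by rewrite [Defs.act G c C]cC0 word_act0 meetx0.
have [c0 Cc0] : Delta G C !=set0.
  by have [c [_ [_ [_ _ ?]]]] := key [::] C0; exists c.
apply: Cinf; split; first by exists c0.
(* [f] reads the letter following [al] in the word of [z], with [c0] as default. By [key] at the
   one-letter word [b], every [b] in [Delta G C] is such a letter for a member of [Z], so
   [Delta G C] lies in the image of a finite set. *)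
pose f (z : isg G) := if z is Some v then head c0 (drop (size al) (val v).1.1)
  else c0.
apply: sub_finite_set (finite_image f fZ) => b bC.
have [c [t [E [Zz /idem_neq0[E0 iE] _ bc]]]] := key [:: b] bC.
exists (idem (al ++ c :: t) E) => //.
by have [v -> ve] := idemE E0 iE; rewrite /f ve /= drop_size_cat.
Qed.

End TightFilters.

Theorem theorem3p27 (d : Order.disp_t) (B : cbDistrLatticeType d) (L : eqType)
    (G : gbds B L) (xi : set (isg G)) :
  is_tight xi <->
    (ultrafilterES xi /\ infinite_type xi) \/
    (filterES xi /\
     exists al : seq L,
       [/\ assoc_word xi (Fin al),
           ultrafilter_idl G al (level xi (Fin al) (size al)) &
           forall A : B, level xi (Fin al) (size al) A -> ~ regular G A]).
Proof.
split=> [tx|[[Ux _]|[Fx [al [aw]]]]].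
- have [Fx _] := tx; have [[al|u] aw _] := assoc_word_ex Fx; last first.
    by left; split; [apply: tight_infinite_ultrafilter => //|]; exists u.
  right; split=> //; exists al; rewrite levelE //; split=> //.
    by apply: tight_finite_ultrafilter => //; case: aw.
  by move=> A; exact: tight_finite_nonregular.
- exact: ultrafilter_tight.
by rewrite levelE //; exact: nonregular_tight.
Qed.
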